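(* Let $n$ be an almost-prime number. Then: \begin{enumerate} \item $\nu_2(p-1)$ does not depend on the choice of the prime divisor $p$ of $n$; that is, $\nu_2(p-1)=\nu_2(p'-1)$ for all primes $p,p'$ dividing $n$. \item If $r$ is a Fermat prime and $r\mid p-1$ for some prime divisor $p$ of $n$, then $r\mid p'-1$ for every prime divisor $p'$ of $n$. \end{enumerate}
   Context: For a positive integer $n$ with positive divisors $1=d_1<d_2<\dots<d_k=n$, define the polynomial $T_n(x)=x^{d_1}+x^{d_2}+\dots+x^{d_k}-kx$. A positive integer $n$ is called weakly almost-prime if $n\mid T_n(x)$ for all integers $x$; it is called almost-prime if it is weakly almost-prime and square-free. $\nu_2(m)$ denotes the exponent of $2$ in the prime factorization of $m$. A Fermat prime is a prime of the form $2^{2^k}+1$. *)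

(* Defs.v *)
From mathcomp Require Import all_boot all_order all_algebra.

Set Implicit Arguments.
Unset Strict Implicit.
Unset Printing Implicit Defensive.

Import GRing.Theory.
Local Open Scope ring_scope.

Definition divisor_poly (n : nat) : {poly int} :=
  (\sum_(d <- divisors n) 'X^d) - (size (divisors n))%:R *: 'X.

Definition weakly_almost_prime (n : nat) : Prop :=
  (0 < n)%N /\ forall x : int, (n%:Z %| (divisor_poly n).[x])%Z.

Definition squarefree (n : nat) : Prop :=
  forall d : nat, (d ^ 2 %| n)%N -> d = 1%N.

Definition almost_prime (n : nat) : Prop :=
  weakly_almost_prime n /\ squarefree n.

Definition fermat_prime (r : nat) : Prop :=
  prime r /\ exists k : nat, r = (2 ^ (2 ^ k) + 1)%N.

(* Main.v *)
(** For a prime [p] dividing [n], reduce the exponents of [T_n] modulo [p - 1]: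
    the result is a polynomial of degree less than [p] vanishing on [F_p], hence
    zero.  So [p] divides the number of divisors [d] of [n] with [P d], for every
    [(p - 1)]-periodic predicate [P] that is false at [1].  If some prime
    [q] dividing [n] is such that multiplication by [q] negates [P], that number
    is the number of divisors of [n / q], a power of 2, which is absurd for odd
    [p].  Predicates [P] of this kind come from sign characters: [d |-> d] modulo
    [2 ^ e.+1] once all divisors are [1] modulo [2 ^ e], and [d |-> d ^ (2 ^ t)]
    modulo the Fermat prime [r] once all [d ^ (2 ^ t.+1)] are [1]. *)
Require Import Defs.
From mathcomp Require Import all_boot.
From mathcomp Require Import all_algebra cyclic finfield zify.

Set Implicit Arguments.
Unset Strict Implicit.
Unset Printing Implicit Defensive.

Import GRing.Theory.

(** * Divisors of square-free numbers *)

Lemma perm_divisors_mul_prime (q m : nat) : prime q -> coprime q m -> 0 < m ->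
  perm_eq (divisors (q * m)) (divisors m ++ [seq q * d | d <- divisors m]).
Proof.
move=> pq cqm m0; have q0 := prime_gt0 pq.
apply: uniq_perm; first exact: divisors_uniq.
  rewrite cat_uniq divisors_uniq map_inj_uniq ?divisors_uniq ?andbT /=; last first.
    by move=> a b /eqP; rewrite eqn_pmul2l // => /eqP.
  apply/hasPn => _ /mapP[d _ ->]; rewrite -dvdn_divisors //.
  apply/negP => /(dvdn_trans (dvdn_mulr d (dvdnn q))).
  by rewrite -[_ %| _]negbK -prime_coprime // cqm.
move=> d; rewrite mem_cat -!dvdn_divisors ?muln_gt0 ?q0 //.
apply/idP/orP => [dqm|[dm|/mapP[e]]]; last 2 first.
- exact: dvdn_mull.
- by rewrite -dvdn_divisors // => em ->; rewrite dvdn_pmul2l.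
case: (boolP (q %| d)) => [/dvdnP[e de]|]; last first.
  by rewrite -prime_coprime // coprime_sym => cdq; left; rewrite -(Gauss_dvdr _ cdq).
right; rewrite de mulnC; apply: map_f; rewrite -dvdn_divisors //.
by rewrite -(dvdn_pmul2l q0) mulnC -de.
Qed.

Lemma squarefree_dvd (m n : nat) : m %| n -> squarefree n -> squarefree m.
Proof. by move=> mn sn d dm; apply: sn; apply: dvdn_trans mn. Qed.

Lemma squarefree_coprime (q m : nat) : prime q -> squarefree (q * m) -> coprime q m.
Proof.
move=> pq sn; rewrite prime_coprime //; apply/negP => /dvdnP[c mE].
have /sn q1 : q ^ 2 %| q * m by rewrite mE mulnCA -mulnn dvdn_mull.
by rewrite q1 in pq.
Qed.

(** Splitting off one prime factor doubles the number of divisors, so for square-free [n] this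
    number is a power of 2. *)
Lemma prime_dvd_size_divisors (p n : nat) : prime p -> 0 < n -> squarefree n ->
  p %| size (divisors n) -> p = 2.
Proof.
move=> pp; elim/ltn_ind: n => n IH n0 sn.
have [n1|n1] := leqP n 1.
  have -> : n = 1 by lia.
  by rewrite dvdn1 => /eqP p1; rewrite p1 in pp.
have pq := pdiv_prime n1; have /dvdnP[m nE] := pdiv_dvd n.
set q := pdiv n in pq nE; rewrite mulnC in nE.
have q1 := prime_gt1 pq.
have m0 : 0 < m by lia.
rewrite nE in sn *.
have cqm := squarefree_coprime pq sn.
rewrite (perm_size (perm_divisors_mul_prime pq cqm m0)) size_cat size_map addnn.
rewrite -mul2n Euclid_dvdM // => /orP[|pm].
  by rewrite dvdn_prime2 // => /eqP.
apply: (IH m) => //; first by rewrite nE ltn_Pmull.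
exact: squarefree_dvd (dvdn_mull q (dvdnn m)) sn.
Qed.

(** * Reduction modulo a prime divisor of n *)

Section ReductionModP.
Local Open Scope ring_scope.

Lemma Fp_dvdz_eq0 (p : nat) (z : int) : prime p -> (p%:Z %| z)%Z ->
  z%:~R = 0 :> 'F_p.
Proof.
move=> pp /dvdzP[c ->]; rewrite rmorphM /= -pmulrn.
by rewrite (pcharf0 (pchar_Fp pp)) mulr0.
Qed.

Lemma divisor_poly_Fp (n p : nat) (a : 'F_p) : weakly_almost_prime n ->
  prime p -> (p %| n)%N ->
  \sum_(d <- divisors n) a ^+ d = (size (divisors n))%:R * a.
Proof.
move=> [_ hn] pp pn.
have : ((divisor_poly n).[(a : nat)%:Z])%:~R = 0 :> 'F_p.
  by apply: Fp_dvdz_eq0 => //; apply: dvdz_trans (hn _); rewrite dvdzE.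
rewrite /divisor_poly hornerD hornerN hornerZ hornerX horner_sum.
rewrite rmorphB rmorphM rmorph_sum /= rmorph_nat -!pmulrn natr_Zp.
move/eqP; rewrite subr_eq0 => /eqP <-; apply: eq_bigr => d _.
by rewrite hornerXn rmorphXn /= -pmulrn natr_Zp.
Qed.

Lemma Fp_poly_eq0 (p : nat) (f : {poly 'F_p}) : prime p -> (size f <= p)%N ->
  (forall a, f.[a] = 0) -> f = 0.
Proof.
move=> pp sf fa; apply: (@roots_geq_poly_eq0 _ f (enum 'F_p)).
- by apply/allP => a _; apply/rootP.
- exact: enum_uniq.
- by rewrite -cardE card_Fp.
Qed.

Lemma expr_Fp_reduce (p d : nat) (a : 'F_p) : prime p -> (0 < d)%N ->
  a ^+ (d.-1 %% p.-1).+1 = a ^+ d.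
Proof.
move=> pp d0; have [->|a0] := eqVneq a 0.
  by rewrite expr0n -(prednK d0) expr0n.
have a1 : a ^+ p.-1 = 1.
  apply: (mulfI a0); rewrite -exprS prednK ?prime_gt0 // mulr1.
  by have := expf_card a; rewrite card_Fp.
rewrite -[in RHS](prednK d0) [in RHS](divn_eq d.-1 p.-1) -addnS exprD mulnC.
by rewrite exprM a1 expr1n mul1r.
Qed.

Lemma prime_dvd_count_divisors (n p : nat) (P : pred nat) :
  weakly_almost_prime n -> prime p -> (p %| n)%N ->
  (forall i j, i = j %[mod p.-1] -> P i = P j) -> ~~ P 1%N ->
  (p %| count P (divisors n))%N.
Proof.
move=> hn pp pn Pmod P1.
have p1 : (0 < p.-1)%N by have := prime_gt1 pp; lia.
have div0 d : d \in divisors n -> (0 < d)%N.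
  by case: hn => n0 _; rewrite -dvdn_divisors // => /(dvdn_gt0 n0).
(* Exponents are reduced into [1..p-1] rather than [0..p-2]: [a ^+ red d = a ^+ d] then holds at
   [a = 0] too, and [f] still has degree below [p]. *)
pose red d := (d.-1 %% p.-1).+1.
have redp d : (red d < p)%N by have := ltn_pmod d.-1 p1; rewrite /red; lia.
pose f : {poly 'F_p} :=
  \sum_(d <- divisors n) 'X^(red d) - (size (divisors n))%:R *: 'X.
have f0 : f = 0.
  apply: Fp_poly_eq0 => // [|a].
    apply/leq_sizeP => j pj; rewrite coefB coefZ coefX coef_sum big1 => [|d _].
      have := prime_gt1 pp; case: eqP => [|_ _]; first lia.
      by rewrite mulr0 subr0.
    by rewrite coefXn; case: eqP => // jE; have := redp d; lia.
  rewrite hornerD hornerN hornerZ hornerX horner_sum.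
  rewrite -(divisor_poly_Fp a hn pp pn) (eq_big_seq (fun d => a ^+ d)) ?subrr //.
  by move=> d /div0 d0; rewrite hornerXn expr_Fp_reduce.
have Pred d : (0 < d)%N -> P (red d) = P d.
  by move=> d0; apply: Pmod; rewrite /red -addn1 modnDml addn1 prednK.
rewrite (dvdn_pcharf (pchar_Fp pp)) -sum1_count natr_sum big_mkcond /=.
(* Sum the coefficients of [f] over the exponents satisfying [P]. *)
have : \sum_(i < p | P i) f`_i = 0 by rewrite f0 big1 // => i _; rewrite coef0.
rewrite (eq_bigr (fun i : 'I_p => \sum_(d <- divisors n) (i == red d :> nat)%:R)).
  rewrite exchange_big /= => S0; apply/eqP; rewrite -[RHS]S0.
  apply: eq_big_seq => d /div0 d0; rewrite -(Pred d) //.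
  have [Pd|Pd] := boolP (P (red d)).
    rewrite (bigD1 (Ordinal (redp d))) //= eqxx big1 ?addr0 // => i /andP[_ ne].
    by rewrite -val_eqE /= in ne; rewrite (negPf ne).
  by rewrite big1 // => i Pi; case: eqP => // iE; rewrite iE (negPf Pd) in Pi.
move=> i Pi; rewrite coefB coefZ coefX coef_sum.
(* As [P] is false at 1, the term in ['X] does not enter the sum. *)
have -> : (i == 1 :> nat) = false by apply/eqP => i1; rewrite i1 (negPf P1) in Pi.
by rewrite mulr0 subr0; apply: eq_bigr => d _; rewrite coefXn.
Qed.

End ReductionModP.

(** * Sign predicates on the divisors of n *)

Lemma no_flipping_prime (n p q : nat) (P : pred nat) : almost_prime n ->
  prime p -> p %| n -> p != 2 -> prime q -> q %| n ->
  (forall i j, i = j %[mod p.-1] -> P i = P j) -> ~~ P 1 ->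
  (forall d, d %| n %/ q -> P (q * d) = ~~ P d) -> False.
Proof.
move=> [hn sn] pp pn p2 pq qn Pmod P1 Pflip.
have := prime_dvd_count_divisors hn pp pn Pmod P1.
case: hn => n0 _; have nE : n = q * (n %/ q) by rewrite mulnC divnK.
set m := n %/ q in nE Pflip.
have m0 : 0 < m by rewrite nE muln_gt0 in n0; case/andP: n0.
rewrite nE in sn *; have cqm := squarefree_coprime pq sn.
(* The divisors of [q * m] pair up as [d] and [q * d], with [P] true for exactly one of each pair,
   so the count is the number of divisors of [m]. *)
have /permP -> := perm_divisors_mul_prime pq cqm m0.
rewrite count_cat count_map.
have /eq_in_count -> : {in divisors m, preim (muln q) P =1 predC P}.
  by move=> d; rewrite -dvdn_divisors //= => /Pflip.
rewrite count_predC => /(prime_dvd_size_divisors pp m0 _) p2'.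
by rewrite p2' ?eqxx // in p2; apply: squarefree_dvd (dvdn_mull q (dvdnn m)) sn.
Qed.

(** If [q] divided [p.-1], divisibility by [q] would be a [p.-1]-periodic predicate, and
    multiplication by [q] negates it on the divisors of [n %/ q], all coprime to [q]. *)
Lemma prime_divisor_ndvd_pred (n p q : nat) : almost_prime n ->
  prime p -> p %| n -> prime q -> q %| n -> ~~ (q %| p.-1).
Proof.
move=> hn pp pn pq qn; apply/negP => qp.
have p2 : p != 2.
  by apply/eqP => pE; rewrite pE dvdn1 in qp; rewrite (eqP qp) in pq.
apply: (@no_flipping_prime n p q (dvdn q)) => //.
- move=> i j ij; rewrite /dvdn -(modn_dvdm i qp) -(modn_dvdm j qp).
  by rewrite ij.
- by rewrite Euclid_dvd1.
move=> d dm; rewrite dvdn_mulr //; symmetry.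
rewrite -prime_coprime //; apply: coprime_dvdr dm _.
by apply: squarefree_coprime; rewrite // mulnC divnK //; case: hn.
Qed.

(** The residues 1 and [u] are closed under multiplication, so the dichotomy passes from primes to
    their products. *)
Lemma divisors_pow_closed (n M N u : nat) : 0 < n -> u * u = 1 %[mod M] ->
  (forall q, prime q -> q %| n -> q ^ N = 1 %[mod M] \/ q ^ N = u %[mod M]) ->
  forall d, d %| n -> d ^ N = 1 %[mod M] \/ d ^ N = u %[mod M].
Proof.
move=> n0 uu hq; elim/ltn_ind => d IH dn.
have d0 := dvdn_gt0 n0 dn.
have [d1|d1] := leqP d 1.
  have -> : d = 1 by lia.
  by left; rewrite exp1n.
have pq := pdiv_prime d1; have /dvdnP[e dE] := pdiv_dvd d.
set q := pdiv d in pq dE.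
have q1 := prime_gt1 pq.
have ed : e < d by nia.
have en : e %| n by apply: dvdn_trans dn; rewrite dE dvdn_mulr.
have qn : q %| n by apply: dvdn_trans dn; rewrite dE dvdn_mull.
rewrite dE expnMn -modnMm.
case: (IH _ ed en) => ->; case: (hq _ pq qn) => ->; rewrite modnMm.
- by left.
- by right; rewrite mul1n.
- by right; rewrite muln1.
- by left.
Qed.

(** On divisors of [n], [d ^ N] modulo [M] is a sign, with [u] in the role of -1. A prime of sign
    [u] would negate the predicate [d ^ N != 1], which is [p.-1]-periodic because [M] divides
    [p.-1]. *)
Lemma prime_divisors_pow_eq1 (n p M N u : nat) : almost_prime n ->
  prime p -> p %| n -> M %| p.-1 -> u * u = 1 %[mod M] -> u != 1 %[mod M] ->
  (forall q, prime q -> q %| n -> q ^ N = 1 %[mod M] \/ q ^ N = u %[mod M]) ->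
  forall q, prime q -> q %| n -> q ^ N = 1 %[mod M].
Proof.
move=> hn pp pn Mp uu u1 hq q pq qn; case: (hq q pq qn) => // qu.
have n0 : 0 < n by case: hn => -[].
have p2 : p != 2.
  apply/eqP => pE; rewrite pE dvdn1 in Mp.
  by rewrite (eqP Mp) !modn1 in u1.
exfalso; apply: (@no_flipping_prime n p q (fun d => d ^ N != 1 %[mod M])) => //.
- move=> i j ij; rewrite -(modnXm N M i) -(modnXm N M j).
  by rewrite -(modn_dvdm i Mp) -(modn_dvdm j Mp) ij.
- by rewrite exp1n eqxx.
move=> d dm; have dn : d %| n by apply: dvdn_trans dm (dvdn_div qn).
rewrite negbK expnMn -modnMm qu.
case: (divisors_pow_closed n0 uu hq dn) => ->; rewrite modnMm.
  by rewrite muln1 u1 eqxx.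
by rewrite uu eqxx (negPf u1).
Qed.

(** * Powers of 2 and Fermat primes dividing p - 1 *)

Lemma prime_divisors_eq1_mod_pow2 (n p e : nat) : almost_prime n ->
  prime p -> p %| n -> 2 ^ e %| p.-1 ->
  forall q, prime q -> q %| n -> 2 ^ e %| q.-1.
Proof.
move=> hn pp pn; elim: e => [|e IH] ep q pq qn; first exact: dvd1n.
have odd_div q' : prime q' -> q' %| n -> odd q'.
  move=> pq' qn'; case: (even_prime pq') => // q2.
  have := prime_divisor_ndvd_pred hn pp pn pq' qn'.
  by rewrite q2 (dvdn_trans _ ep) // expnS dvdn_mulr.
have {}IH := IH (dvdn_trans (dvdn_exp2l 2 (leqnSn e)) ep).
(* The first step is mere oddness: the sign argument needs [1 + 2 ^ e] to square to 1 modulo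
   [2 ^ e.+1], which fails for [e = 0]. *)
case: e => [|e] in ep IH *.
  by have := odd_div q pq qn; rewrite expn1 dvdn2; case: q {pq qn} => //= q; rewrite negbK.
set M := 2 ^ e.+2 in ep *; set h := 2 ^ e.+1 in IH *.
have Mh : M = h * 2 by rewrite /M expnSr.
have h0 : 0 < h by rewrite expn_gt0.
have hh : h * h = M * 2 ^ e.
  by rewrite Mh /h expnS; nia.
have /eqP : q ^ 1 = 1 %[mod M].
  apply: (@prime_divisors_pow_eq1 n p M 1 (1 + h)) => //.
  - have -> : (1 + h) * (1 + h) = (1 + 2 ^ e) * M + 1 by nia.
    by rewrite modnMDl.
  - rewrite -[X in _ != X %[mod _]]addn0 eqn_modDl mod0n modn_small; lia.
  move=> q' pq' qn'; have /dvdnP[a aE] := IH q' pq' qn'.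
  have -> : q' ^ 1 = 1 + a * h by rewrite expn1; have := prime_gt0 pq'; lia.
  (* The parity of [a] decides between the two lifts 1 and [1 + h] of 1 from modulus [h] to [M]. *)
  rewrite -(odd_double_half a); case: (odd a) => /=; [right|left].
    have -> : 1 + (1 + a./2.*2) * h = a./2 * M + (1 + h).
      by rewrite Mh -muln2; move: a./2 (h) => b c; lia.
    by rewrite modnMDl.
  have -> : 1 + (0 + a./2.*2) * h = a./2 * M + 1.
    by rewrite Mh -muln2; move: a./2 (h) => b c; lia.
  by rewrite modnMDl.
by rewrite expn1 eqn_mod_dvd ?prime_gt0 // subn1.
Qed.

Lemma prime_sqr_eq1_mod (r x : nat) : prime r -> 0 < x -> x * x = 1 %[mod r] ->
  x = 1 %[mod r] \/ x = r.-1 %[mod r].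
Proof.
move=> pr x0 /eqP; have r1 := prime_gt1 pr.
rewrite eqn_mod_dvd ?muln_gt0 ?x0 //.
have -> : x * x - 1 = (x - 1) * (x + 1) by nia.
rewrite Euclid_dvdM // => /orP[xr|xr]; [left|right]; apply/eqP.
  by rewrite eqn_mod_dvd.
have -> : (x == r.-1 %[mod r]) = (x + 1 == r.-1 + 1 %[mod r]) by rewrite eqn_modDr.
by rewrite [r.-1 + 1]addn1 prednK ?modnn ?prime_gt0.
Qed.

(** Since [r - 1] is a power of 2, one can descend from Fermat's little theorem to exponent 1 by
    square roots: each root of 1 modulo [r] is 1 or -1, and the sign argument excludes -1. *)
Lemma prime_divisors_eq1_mod_fermat (n p r : nat) : almost_prime n ->
  fermat_prime r -> prime p -> p %| n -> r %| p.-1 ->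
  forall q, prime q -> q %| n -> r %| q.-1.
Proof.
move=> hn [pr [k rE]] pp pn rp.
(* This makes 1 and -1 distinct modulo [r]. *)
have r2 : 2 < r.
  by rewrite rE addn1 ltnS -[X in X < _](expn0 2) ltn_exp2l ?expn_gt0.
have cop q : prime q -> q %| n -> coprime q r.
  move=> pq qn; rewrite prime_coprime // dvdn_prime2 //.
  by apply: contraNneq (prime_divisor_ndvd_pred hn pp pn pq qn) => ->.
(* [j] counts the square roots taken; [j = 2 ^ k] leaves exponent 1. *)
suff pow j : j <= 2 ^ k ->
    forall q, prime q -> q %| n -> q ^ (2 ^ (2 ^ k - j)) = 1 %[mod r].
  move=> q pq qn; have /eqP := pow _ (leqnn _) q pq qn.
  by rewrite subnn expn0 expn1 eqn_mod_dvd ?prime_gt0 // subn1.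
elim: j => [|j IH] jk q pq qn.
  have := Euler_exp_totient (cop q pq qn).
  by rewrite totient_prime // {1}rE addn1 subn0.
have {}IH := IH (ltnW jk).
apply: (@prime_divisors_pow_eq1 n p r _ r.-1) => //.
- have -> : r.-1 * r.-1 = (r - 2) * r + 1 by nia.
  by rewrite modnMDl.
- rewrite !modn_small; lia.
move=> q' pq' qn'; apply: prime_sqr_eq1_mod => //; first by rewrite expn_gt0 prime_gt0.
by rewrite -expnD addnn -mul2n -expnS -subSn // subSS IH.
Qed.

Theorem theorem1p4 (n : nat) (hn : almost_prime n) :
  (forall p p' : nat, prime p -> p %| n -> prime p' -> p' %| n ->
     logn 2 (p - 1) = logn 2 (p' - 1))
  /\
  (forall r : nat, fermat_prime r ->
     (exists p : nat, [/\ prime p, p %| n & r %| p - 1]) ->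
     forall p' : nat, prime p' -> p' %| n -> r %| p' - 1).
Proof.
split=> [p p' pp pn pp' pn'|r fr [p [pp pn rp]] p' pp' pn']; last first.
  rewrite !subn1 in rp *.
  exact: (prime_divisors_eq1_mod_fermat hn fr pp pn rp pp' pn').
(* By symmetry one inequality suffices: the full power of 2 in [q - 1] divides [q' - 1]. *)
have le q q' : prime q -> q %| n -> prime q' -> q' %| n ->
    logn 2 (q - 1) <= logn 2 (q' - 1).
  move=> pq qn pq' qn'; rewrite -pfactor_dvdn ?subn_gt0 ?prime_gt1 // !subn1.
  apply: (prime_divisors_eq1_mod_pow2 hn pq qn _ pq' qn').
  exact: pfactor_dvdnn.
by apply/eqP; rewrite eqn_leq !le.
Qed.
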